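(* Let $A=[a_{ij}]\in\mathcal{M}_3(\mathbb{H})$ be a strictly upper triangular (hence nilpotent) matrix. Then $W(A)$ is convex if and only if $a_{13}^*a_{12}a_{23}\in\mathbb{R}$.
   Context: $\mathbb{H}$ denotes the real quaternions with conjugation $q\mapsto q^*$, and $\mathbb{R}\subset\mathbb{H}$ as the real multiples of $1$. The numerical range of $A\in\mathcal{M}_n(\mathbb{H})$ is $W(A)=\{\mathbf{x}^*A\mathbf{x}:\mathbf{x}\in\mathbb{H}^n,\ \mathbf{x}^*\mathbf{x}=1\}$, with $\mathbf{x}^*$ the conjugate transpose. *)

(* Defs.v *)
From Stdlib Require Import Reals.
Open Scope R_scope.

Record quat := Quat { qre : R; qi : R; qj : R; qk : R }.

Definition qzero : quat := Quat 0 0 0 0.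
Definition qone : quat := Quat 1 0 0 0.

Definition qadd (p q : quat) : quat :=
  Quat (qre p + qre q) (qi p + qi q) (qj p + qj q) (qk p + qk q).

Definition qmul (p q : quat) : quat :=
  Quat (qre p * qre q - qi p * qi q - qj p * qj q - qk p * qk q)
       (qre p * qi q + qi p * qre q + qj p * qk q - qk p * qj q)
       (qre p * qj q - qi p * qk q + qj p * qre q + qk p * qi q)
       (qre p * qk q + qi p * qj q - qj p * qi q + qk p * qre q).

Definition qconj (q : quat) : quat := Quat (qre q) (- qi q) (- qj q) (- qk q).

Definition qscale (t : R) (q : quat) : quat :=
  Quat (t * qre q) (t * qi q) (t * qj q) (t * qk q).

Definition qIsReal (q : quat) : Prop := qi q = 0 /\ qj q = 0 /\ qk q = 0.

(* 3x3 quaternion matrices and vectors in H^3, indices 0,1,2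
   (paper's indices 1,2,3). Values outside the range are irrelevant. *)
Definition mat3 := nat -> nat -> quat.
Definition vec3 := nat -> quat.

Definition sum3 (f : nat -> quat) : quat := qadd (qadd (f 0%nat) (f 1%nat)) (f 2%nat).

Definition vnorm2 (x : vec3) : quat := sum3 (fun i => qmul (qconj (x i)) (x i)).

Definition quadform (A : mat3) (x : vec3) : quat :=
  sum3 (fun i => sum3 (fun j => qmul (qmul (qconj (x i)) (A i j)) (x j))).

Definition numrange (A : mat3) (q : quat) : Prop :=
  exists x : vec3, vnorm2 x = qone /\ quadform A x = q.

Definition convex (S : quat -> Prop) : Prop :=
  forall p q t, S p -> S q -> 0 <= t <= 1 ->
    S (qadd (qscale t p) (qscale (1 - t) q)).

Definition strictly_upper3 (A : mat3) : Prop :=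
  forall i j : nat, (i < 3)%nat -> (j < 3)%nat -> (j <= i)%nat -> A i j = qzero.

(* Main.v *)
Require Import Defs.
From Stdlib Require Import Reals Lra Psatz.
Open Scope R_scope.

(** Write [a], [b], [c] for the entries (1,2), (1,3), (2,3) of [A].

    Necessity: suppose [b* a c] is not real.  The cubic
    [m^3 - m (|a|^2 + |b|^2 + |c|^2) - 2 Re (b* a c)] has a root [m > |a|], and two
    completions of squares show that [m |x|^2 - 2 Re (x* A x) >= 0], with equality
    exactly on the right line spanned by one explicit vector.  Hence [Re <= m/2] on
    [W(A)], and the point of [W(A)] with real part [m/2] is not real, since its
    imaginary part comes from that of [b* a c].  As [W(A)] is stable under
    [q -> u* q u] for unit [u], it also contains the conjugate of that point, but
    not the midpoint [m/2] of the two.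

    Sufficiency: if [b* a c] is real, a diagonal unitary makes [A] real.  Splitting
    a quaternionic vector as [y + z j] with complex [y], [z] shows that [W(A)] is the
    rotation about the real axis of the complex numerical range, which is convex by
    the Toeplitz-Hausdorff argument. *)

(** * Quaternion arithmetic and the quadratic form in coordinates *)

Definition qnorm2 (q : quat) : R :=
  qre q * qre q + qi q * qi q + qj q * qj q + qk q * qk q.

Definition imnorm2 (q : quat) : R := qi q * qi q + qj q * qj q + qk q * qk q.

Definition imnorm (q : quat) : R := sqrt (imnorm2 q).

Definition triform (a b c x y z : quat) : quat :=
  qadd (qadd (qmul (qmul (qconj x) a) y) (qmul (qmul (qconj x) b) z))
       (qmul (qmul (qconj y) c) z).

Definition qdiff (p q : quat) : quat := qadd p (qscale (-1) q).

Ltac quat_unfold :=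
  cbv [qmul qadd qconj qscale qzero qone qnorm2 imnorm2 triform qdiff qre qi qj qk] in *.
Ltac quat_ring :=
  repeat match goal with
    |- context [?q] => is_var q; match type of q with quat => case q; intros end
  end;
  cbv [qmul qadd qconj qscale qzero qone qnorm2 imnorm2 triform qdiff qre qi qj qk];
  match goal with |- Quat _ _ _ _ = _ => f_equal; ring | _ => ring end.

Lemma quat_ext (p q : quat) :
  qre p = qre q -> qi p = qi q -> qj p = qj q -> qk p = qk q -> p = q.
Proof. destruct p, q; simpl; congruence. Qed.

Lemma qnorm2_ge0 (q : quat) : 0 <= qnorm2 q.
Proof. unfold qnorm2; nra. Qed.

Lemma imnorm2_ge0 (q : quat) : 0 <= imnorm2 q.
Proof. unfold imnorm2; nra. Qed.

Lemma qnorm2_eq0 (q : quat) : qnorm2 q = 0 -> q = qzero.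
Proof. intro h; unfold qnorm2 in h; apply quat_ext; simpl; nra. Qed.

Lemma qmulA (p q r : quat) : qmul p (qmul q r) = qmul (qmul p q) r.
Proof. quat_ring. Qed.

Lemma qconj_mul (p q : quat) : qconj (qmul p q) = qmul (qconj q) (qconj p).
Proof. quat_ring. Qed.

Lemma qmul_add_l (p q r : quat) : qmul (qadd p q) r = qadd (qmul p r) (qmul q r).
Proof. quat_ring. Qed.

Lemma qmul_add_r (p q r : quat) : qmul r (qadd p q) = qadd (qmul r p) (qmul r q).
Proof. quat_ring. Qed.

Lemma qnorm2_mul (p q : quat) : qnorm2 (qmul p q) = qnorm2 p * qnorm2 q.
Proof. quat_ring. Qed.

Lemma qnorm2_conj (q : quat) : qnorm2 (qconj q) = qnorm2 q.
Proof. quat_ring. Qed.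

Lemma qdiff_eq0 (p q : quat) : qnorm2 (qdiff p q) = 0 -> p = q.
Proof.
  intro h; apply qnorm2_eq0 in h; destruct p, q; quat_unfold.
  injection h; intros; f_equal; lra.
Qed.

Lemma qscale_eq0 (t : R) (q : quat) : t <> 0 -> qscale t q = qzero -> q = qzero.
Proof.
  intros ht h; unfold qscale, qzero in h; injection h; intros h3 h2 h1 h0.
  apply Rmult_integral in h0, h1, h2, h3; apply quat_ext; simpl; tauto.
Qed.

Lemma imnorm2_eq0 (q : quat) : imnorm2 q = 0 -> qIsReal q.
Proof. intro h; unfold imnorm2 in h; repeat split; nra. Qed.

(** Multiplying [z* g z] by [z] on the left and [z*] on the right gives [|z|^4 g], while a real
    number in the middle only picks up the factor [|z|^2]. *)
Lemma qIsReal_conj_mul (g z : quat) :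
  qnorm2 z <> 0 -> qIsReal (qmul (qmul (qconj z) g) z) -> qIsReal g.
Proof.
  intros hz h.
  assert (e : qscale (qnorm2 z * qnorm2 z) g
            = qmul (qmul z (qmul (qmul (qconj z) g) z)) (qconj z)) by quat_ring.
  destruct (qmul (qmul (qconj z) g) z) as [r p1 p2 p3]; destruct h as [h1 [h2 h3]].
  simpl in h1, h2, h3; subst.
  assert (e' : qmul (qmul z (Quat r 0 0 0)) (qconj z) = Quat (r * qnorm2 z) 0 0 0)
    by quat_ring.
  rewrite e' in e; destruct g as [g0 g1 g2 g3]; unfold qscale in e; simpl in e.
  injection e; intros.
  assert (qnorm2 z * qnorm2 z <> 0) by nra.
  repeat split; simpl; nra.
Qed.

Lemma numrange_triform (A : mat3) (q : quat) : strictly_upper3 A ->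
  (numrange A q <->
   exists x y z, qnorm2 x + qnorm2 y + qnorm2 z = 1 /\
     triform (A 0%nat 1%nat) (A 0%nat 2%nat) (A 1%nat 2%nat) x y z = q).
Proof.
  intro hA.
  assert (hn : forall x, vnorm2 x
     = Quat (qnorm2 (x 0%nat) + qnorm2 (x 1%nat) + qnorm2 (x 2%nat)) 0 0 0).
  { intro x; unfold vnorm2, sum3.
    generalize (x 0%nat) (x 1%nat) (x 2%nat); intros; quat_ring. }
  assert (hq : forall x, quadform A x
     = triform (A 0%nat 1%nat) (A 0%nat 2%nat) (A 1%nat 2%nat)
         (x 0%nat) (x 1%nat) (x 2%nat)).
  { intro x; unfold quadform, sum3.
    rewrite (hA 0%nat 0%nat), (hA 1%nat 0%nat), (hA 1%nat 1%nat), (hA 2%nat 0%nat),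
      (hA 2%nat 1%nat), (hA 2%nat 2%nat) by auto with arith.
    generalize (x 0%nat) (x 1%nat) (x 2%nat) (A 0%nat 1%nat) (A 0%nat 2%nat) (A 1%nat 2%nat).
    intros; quat_ring. }
  split.
  - intros [x [h1 h2]]; exists (x 0%nat), (x 1%nat), (x 2%nat).
    rewrite hn in h1; rewrite hq in h2; split; auto.
    unfold qone in h1; congruence.
  - intros [x [y [z [h1 h2]]]].
    exists (fun i => match i with 0%nat => x | 1%nat => y | _ => z end).
    rewrite hn, hq, h1; auto.
Qed.

Lemma numrange_normalize (A : mat3) (x y z : quat) : strictly_upper3 A ->
  0 < qnorm2 x + qnorm2 y + qnorm2 z ->
  numrange A (qscale (/ (qnorm2 x + qnorm2 y + qnorm2 z))
    (triform (A 0%nat 1%nat) (A 0%nat 2%nat) (A 1%nat 2%nat) x y z)).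
Proof.
  intros hA hn; apply numrange_triform; auto.
  set (n := qnorm2 x + qnorm2 y + qnorm2 z) in *.
  assert (hs : exists s, s * s = / n).
  { exists (sqrt (/ n)); apply sqrt_sqrt; left; apply Rinv_0_lt_compat; auto. }
  destruct hs as [s hs].
  exists (qscale s x), (qscale s y), (qscale s z).
  rewrite <- hs; split.
  - replace (qnorm2 (qscale s x) + qnorm2 (qscale s y) + qnorm2 (qscale s z))
      with ((s * s) * n) by (unfold n; quat_ring).
    rewrite hs; field; lra.
  - quat_ring.
Qed.

(** * Rotation about the real axis *)

(* The rotation by a half-turn about the bisector of [Im q] and the [i]-axis. *)
Lemma rotate_to_complex (q : quat) :
  exists u, qnorm2 u = 1 /\
    qmul (qmul (qconj u) q) u = Quat (qre q) (imnorm q) 0 0 /\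
    qmul (qmul u (Quat (qre q) (imnorm q) 0 0)) (qconj u) = q.
Proof.
  assert (hu : exists u, qnorm2 u = 1 /\
    qmul (qmul (qconj u) q) u = Quat (qre q) (imnorm q) 0 0).
  { pose proof (sqrt_pos (imnorm2 q)) as hs0.
    pose proof (sqrt_sqrt _ (imnorm2_ge0 q)) as hs.
    fold (imnorm q) in hs, hs0; set (s := imnorm q) in *; clearbody s.
    destruct q as [r p1 p2 p3]; unfold imnorm2 in hs; simpl in *.
    set (m := (p1 + s) * (p1 + s) + p2 * p2 + p3 * p3).
    destruct (Req_dec m 0) as [hm | hm].
    (* Here [Im q] is a nonpositive multiple of [i] and the bisector degenerates; the half-turn
       about [j] works instead. *)
    - assert (h : qIsReal (Quat 0 (p1 + s) p2 p3)) by (apply imnorm2_eq0; exact hm).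
      destruct h as [h1 [h2 h3]]; simpl in h1, h2, h3.
      replace p1 with (- s) in * by lra.
      subst; exists (Quat 0 0 1 0); split; quat_ring.
    - assert (hm0 : 0 < m) by (unfold m in *; nra).
      assert (ht : exists t, t * t = / m).
      { exists (sqrt (/ m)); apply sqrt_sqrt; left; apply Rinv_0_lt_compat; auto. }
      destruct ht as [t ht].
      assert (htm : t * t * m = 1) by (rewrite ht; field; lra).
      assert (hp : p3 * p3 = s * s - p1 * p1 - p2 * p2) by lra.
      exists (Quat 0 (t * (p1 + s)) (t * p2) (t * p3)); unfold m in htm; split.
      + unfold qnorm2; simpl; rewrite <- htm; ring.
      (* Expanding the square gives [m = 2 s (s + p1)], as [s] is the length of [Im q]. *)
      + assert (hts : t * t * (2 * s * (s + p1)) = 1)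
          by (rewrite <- htm; replace (p3 * p3) with (s * s - p1 * p1 - p2 * p2); ring).
        unfold qmul, qconj; apply quat_ext; simpl.
        * transitivity (r * 1); [rewrite <- htm |]; ring.
        * transitivity (s * 1); [rewrite <- hts; ring [hp] | ring].
        * ring [hp].
        * ring [hp]. }
  destruct hu as [u [h1 h2]]; exists u; repeat split; auto.
  rewrite <- h2.
  transitivity (qscale (qnorm2 u * qnorm2 u) q); [| rewrite h1]; quat_ring.
Qed.

(** Multiplying the vector by [u] on the right keeps its norm and turns the value [q] into
    [u* q u]. *)
Lemma numrange_conj_unit (A : mat3) (u q : quat) : strictly_upper3 A ->
  qnorm2 u = 1 -> numrange A q -> numrange A (qmul (qmul (qconj u) q) u).
Proof.
  intros hA hu h; apply numrange_triform in h; auto.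
  destruct h as [x [y [z [h1 h2]]]]; apply numrange_triform; auto.
  exists (qmul x u), (qmul y u), (qmul z u); split.
  - rewrite !qnorm2_mul, hu; lra.
  - rewrite <- h2; unfold triform.
    rewrite !qmul_add_r, !qmul_add_l, !qconj_mul, !qmulA; reflexivity.
Qed.

(** Reduces membership to the closed upper half of the complex plane. *)
Lemma numrange_rotate (A : mat3) (q : quat) : strictly_upper3 A ->
  (numrange A q <-> numrange A (Quat (qre q) (imnorm q) 0 0)).
Proof.
  intro hA; destruct (rotate_to_complex q) as [u [h1 [h2 h3]]]; split; intro h.
  - rewrite <- h2; apply numrange_conj_unit; auto.
  - rewrite <- h3.
    replace u with (qconj (qconj u)) at 1 by quat_ring.
    apply numrange_conj_unit; auto; rewrite qnorm2_conj; auto.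
Qed.

Lemma numrange_conj (A : mat3) (q : quat) : strictly_upper3 A ->
  numrange A q -> numrange A (qconj q).
Proof.
  intros hA h; apply numrange_rotate in h; auto; apply numrange_rotate; auto.
  replace (imnorm (qconj q)) with (imnorm q); auto.
  unfold imnorm; f_equal; quat_ring.
Qed.

(** * Necessity *)

(** The Moore determinant of the Hermitian matrix [m - A - A*]; note that [A + A*] has the form
    [2 Re x* A x]. *)
Definition cubic (a b c : quat) (m : R) : R :=
  m * m * m - m * (qnorm2 a + qnorm2 b + qnorm2 c)
  - 2 * qre (qmul (qmul (qconj b) a) c).

(** The intermediate value theorem between [|a|] and a large [M]. As [b* a c] is not real, its real
    part is strictly below [|a| |b| |c|] in absolute value; with [2 |b| |c| <= |b|^2 + |c|^2] this
    makes the cubic negative at [|a|]. *)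
Lemma cubic_root (a b c : quat) : ~ qIsReal (qmul (qmul (qconj b) a) c) ->
  exists m, 0 < m /\ qnorm2 a < m * m /\ cubic a b c m = 0.
Proof.
  intro hr.
  pose proof (qnorm2_ge0 a) as ha; pose proof (qnorm2_ge0 b) as hb;
  pose proof (qnorm2_ge0 c) as hc.
  assert (ht : qre (qmul (qmul (qconj b) a) c) * qre (qmul (qmul (qconj b) a) c)
    < qnorm2 a * qnorm2 b * qnorm2 c).
  { replace (qnorm2 a * qnorm2 b * qnorm2 c) with (qnorm2 (qmul (qmul (qconj b) a) c))
      by (rewrite !qnorm2_mul, qnorm2_conj; ring).
    assert (imnorm2 (qmul (qmul (qconj b) a) c) <> 0)
      by (intro h; apply hr, imnorm2_eq0, h).
    pose proof (imnorm2_ge0 (qmul (qmul (qconj b) a) c)).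
    unfold qnorm2, imnorm2 in *; lra. }
  unfold cubic.
  set (t := qre (qmul (qmul (qconj b) a) c)) in *; clearbody t; clear hr.
  set (na := qnorm2 a) in *; set (nb := qnorm2 b) in *; set (nc := qnorm2 c) in *.
  clearbody na nb nc; clear a b c.
  pose proof (sqrt_pos na) as hs0; pose proof (sqrt_sqrt na ha) as hs.
  set (s := sqrt na) in *; clearbody s.
  assert (hs1 : 0 < s) by (destruct hs0 as [|<-]; nra).
  assert (h1 : - (2 * t) < s * (nb + nc)).
  { destruct (Rlt_le_dec (- (2 * t)) 0) as [h | h]; [nra |].
    apply Rsqr_incrst_0; unfold Rsqr; try nra.
    pose proof (Rle_0_sqr (nb - nc)); unfold Rsqr in *.
    replace (s * (nb + nc) * (s * (nb + nc)))
      with (na * ((nb - nc) * (nb - nc)) + 4 * (na * nb * nc)) by (rewrite <- hs; ring).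
    nra. }
  set (f := fun m => m * m * m - m * (na + nb + nc) - 2 * t).
  (* This choice gives [M^2 >= na + nb + nc + 1] and [M >= 1 + 2 t], hence [f M >= 1]. *)
  set (M := 1 + (na + nb + nc) + 2 * Rabs t).
  pose proof (Rabs_pos t) as ht0; pose proof (Rle_abs t) as ht1.
  assert (hsM : s < M) by (unfold M; nra).
  assert (hfs : f s < 0).
  { replace (f s) with (- (2 * t) - s * (nb + nc)) by (unfold f; rewrite <- hs; ring).
    lra. }
  assert (hfM : 0 < f M).
  { assert (hM : na + nb + nc + 1 <= M * M) by (unfold M; nra).
    assert (hM0 : 1 + 2 * t <= M) by (unfold M; lra).
    assert (0 < M) by lra.
    assert (0 <= M * (M * M - (na + nb + nc) - 1)) by (apply Rmult_le_pos; lra).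
    unfold f; nra. }
  assert (hf : continuity f) by (unfold f; reg).
  destruct (IVT f s M hf hsM hfs hfM) as [m [[hm1 hm2] hm]].
  assert (m <> s) by (intro; subst m; lra).
  exists m; repeat split; [lra | nra | exact hm].
Qed.

(** * Completion of squares at a root of the cubic *)

Section CompletedSquares.

Variables (a b c : quat) (m : R).
Hypotheses (hm : 0 < m) (hP : qnorm2 a < m * m) (hroot : cubic a b c m = 0).

(** Eliminating [x] from the form of [m - A - A*] leaves the Schur complement of the corner [m]:
    [pivot / m] is its first diagonal entry and [- schur / m] its off-diagonal one. *)
Definition pivot : R := m * m - qnorm2 a.
Definition schur : quat := qadd (qscale m c) (qmul (qconj a) b).

(** The [L D L*] factorisation of [m - A - A*], cleared of denominators. The third square has a
    coefficient divisible by [cubic a b c m], so it vanishes at a root. *)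
Lemma completed_squares (x y z : quat) :
  m * pivot * (m * (qnorm2 x + qnorm2 y + qnorm2 z) - 2 * qre (triform a b c x y z))
  = pivot * qnorm2 (qdiff (qscale m x) (qadd (qmul a y) (qmul b z)))
    + qnorm2 (qdiff (qscale pivot y) (qmul schur z)).
Proof.
  transitivity (pivot * qnorm2 (qdiff (qscale m x) (qadd (qmul a y) (qmul b z)))
    + qnorm2 (qdiff (qscale pivot y) (qmul schur z)) + m * cubic a b c m * qnorm2 z).
  (* Norms and cross terms are expanded separately, so that the final identity is one between real
     atoms rather than quaternion coordinates. *)
  - assert (e1 : qnorm2 (qdiff (qscale m x) (qadd (qmul a y) (qmul b z)))
      = m * m * qnorm2 x - 2 * m * qre (triform a b c x y z)
        + 2 * m * qre (qmul (qmul (qconj y) c) z) + qnorm2 (qadd (qmul a y) (qmul b z))).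
    { replace (triform a b c x y z)
        with (qadd (qmul (qconj x) (qadd (qmul a y) (qmul b z))) (qmul (qmul (qconj y) c) z))
        by quat_ring.
      generalize (qadd (qmul a y) (qmul b z)) (qmul (qmul (qconj y) c) z).
      intros; quat_ring. }
    assert (e2 : qnorm2 (qadd (qmul a y) (qmul b z))
      = qnorm2 a * qnorm2 y + qnorm2 b * qnorm2 z
        + 2 * qre (qmul (qmul (qconj y) (qmul (qconj a) b)) z)) by quat_ring.
    assert (e3 : qnorm2 (qdiff (qscale pivot y) (qmul schur z))
      = pivot * pivot * qnorm2 y - 2 * pivot * qre (qmul (qmul (qconj y) schur) z)
        + qnorm2 schur * qnorm2 z)
      by (generalize pivot schur; intros; quat_ring).
    assert (e4 : qre (qmul (qmul (qconj y) schur) z)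
      = m * qre (qmul (qmul (qconj y) c) z)
        + qre (qmul (qmul (qconj y) (qmul (qconj a) b)) z))
      by (unfold schur; generalize (qmul (qconj a) b); intros; quat_ring).
    assert (e5 : qnorm2 schur = m * m * qnorm2 c + qnorm2 a * qnorm2 b
        + 2 * m * qre (qmul (qmul (qconj b) a) c)) by (unfold schur; quat_ring).
    rewrite e1, e2, e3, e4, e5; unfold pivot, cubic.
    generalize (qre (triform a b c x y z)) (qre (qmul (qmul (qconj b) a) c))
      (qre (qmul (qmul (qconj y) c) z))
      (qre (qmul (qmul (qconj y) (qmul (qconj a) b)) z))
      (qnorm2 a) (qnorm2 b) (qnorm2 c) (qnorm2 x) (qnorm2 y) (qnorm2 z).
    intros; ring.
  - rewrite hroot; ring.
Qed.

Lemma extremal_vector (x y z : quat) :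
  qnorm2 x + qnorm2 y + qnorm2 z = 1 -> qre (triform a b c x y z) = m / 2 ->
  qscale m x = qadd (qmul a y) (qmul b z) /\ qscale pivot y = qmul schur z.
Proof.
  intros hn hr; pose proof (completed_squares x y z) as e; rewrite hn, hr in e.
  assert (hP0 : 0 < pivot) by (unfold pivot; lra).
  pose proof (qnorm2_ge0 (qdiff (qscale m x) (qadd (qmul a y) (qmul b z)))) as h1.
  pose proof (qnorm2_ge0 (qdiff (qscale pivot y) (qmul schur z))) as h2.
  split; apply qdiff_eq0; nra.
Qed.

(** At an extremal vector, [pivot] times the value is a real number plus [z* (schur* c) z], and
    [schur* c = m |c|^2 + b* a c]. So a real value forces [b* a c] to be real. *)
Lemma extremal_real (x y z : quat) :
  qnorm2 x + qnorm2 y + qnorm2 z = 1 -> triform a b c x y z = Quat (m / 2) 0 0 0 ->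
  qIsReal (qmul (qmul (qconj b) a) c).
Proof.
  intros hn hq; assert (hP0 : 0 < pivot) by (unfold pivot; lra).
  destruct (extremal_vector x y z hn) as [h1 h2]; [rewrite hq; reflexivity |].
  (* By back-substitution, [z = 0] would make the whole unit vector zero. *)
  assert (hz : qnorm2 z <> 0).
  { intro hz; apply qnorm2_eq0 in hz; subst z.
    assert (hy : y = qzero) by (apply (qscale_eq0 pivot); [lra | rewrite h2; quat_ring]).
    subst y.
    assert (hx : x = qzero) by (apply (qscale_eq0 m); [lra | rewrite h1; quat_ring]).
    subst x.
    quat_unfold; lra. }
  assert (e : qscale pivot (triform a b c x y z)
    = qadd (Quat (pivot * m * qnorm2 x) 0 0 0)
        (qmul (qmul (qconj z) (qmul (qconj schur) c)) z)).
  { transitivity (qadd (qscale pivot (qmul (qconj x) (qadd (qmul a y) (qmul b z))))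
                       (qmul (qmul (qconj (qscale pivot y)) c) z)).
    - generalize pivot; intro; quat_ring.
    - rewrite h2, <- h1; generalize pivot schur; intros; quat_ring. }
  assert (hd : qIsReal (qmul (qconj schur) c)).
  { apply (qIsReal_conj_mul _ z hz); rewrite hq in e.
    destruct (qmul (qmul (qconj z) (qmul (qconj schur) c)) z).
    unfold qadd, qscale in e; simpl in e; injection e; intros.
    repeat split; simpl; lra. }
  assert (e' : qmul (qconj schur) c
    = qadd (Quat (m * qnorm2 c) 0 0 0) (qmul (qmul (qconj b) a) c))
    by (unfold schur; quat_ring).
  rewrite e' in hd; destruct hd as [k1 [k2 k3]]; simpl in k1, k2, k3.
  repeat split; simpl; lra.
Qed.

Lemma extremal_exists : exists x y z,
  0 < qnorm2 x + qnorm2 y + qnorm2 z /\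
  2 * qre (triform a b c x y z) = m * (qnorm2 x + qnorm2 y + qnorm2 z).
Proof.
  assert (hP0 : 0 < pivot) by (unfold pivot; lra).
  (* A kernel vector of [m - A - A*]: starting from [z = pivot], back-substitution gives [y = schur]
     and then [m x = a y + b z]. *)
  set (z := Quat pivot 0 0 0); set (w := qadd (qmul a schur) (qmul b z)).
  exists (qscale (/ m) w), schur, z; split.
  - pose proof (qnorm2_ge0 (qscale (/ m) w)); pose proof (qnorm2_ge0 schur).
    assert (0 < qnorm2 z) by (unfold z, qnorm2; simpl; nra).
    lra.
  - pose proof (completed_squares (qscale (/ m) w) schur z) as e.
    replace (qscale m (qscale (/ m) w)) with w in e
      by (destruct w; unfold qscale; simpl; f_equal; field; lra).
    fold w in e.
    replace (qnorm2 (qdiff w w)) with 0 in e by quat_ring.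
    replace (qnorm2 (qdiff (qscale pivot schur) (qmul schur z))) with 0 in e
      by (unfold z; generalize pivot schur; intros; quat_ring).
    assert (hmP : m * pivot <> 0) by nra.
    apply (Rmult_eq_reg_l (m * pivot)); auto; lra.
Qed.

End CompletedSquares.

Lemma convex_numrange_real (A : mat3) : strictly_upper3 A -> convex (numrange A) ->
  qIsReal (qmul (qmul (qconj (A 0%nat 2%nat)) (A 0%nat 1%nat)) (A 1%nat 2%nat)).
Proof.
  intros hA hc.
  set (a := A 0%nat 1%nat); set (b := A 0%nat 2%nat); set (c := A 1%nat 2%nat).
  destruct (Req_dec (imnorm2 (qmul (qmul (qconj b) a) c)) 0) as [h0 | h0];
    [apply imnorm2_eq0; auto |].
  destruct (cubic_root a b c) as [m [hm [hP hroot]]].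
  { intros [k1 [k2 k3]]; apply h0; unfold imnorm2; rewrite k1, k2, k3; ring. }
  destruct (extremal_exists a b c m hm hP hroot) as [x [y [z [hn hr]]]].
  pose proof (numrange_normalize A x y z hA hn) as hp; fold a b c in hp.
  set (p := qscale _ _) in hp.
  assert (hp0 : qre p = m / 2).
  { unfold p, qscale; cbn [qre].
    replace (qre (triform a b c x y z))
      with (m * (qnorm2 x + qnorm2 y + qnorm2 z) / 2) by lra.
    field; lra. }
  (* Since [Re p = m / 2], the midpoint of [p] and its conjugate is the real number [m / 2]. *)
  assert (hmid := hc p (qconj p) (1 / 2) hp (numrange_conj A p hA hp) ltac:(lra)).
  replace (qadd _ _) with (Quat (m / 2) 0 0 0) in hmid
    by (rewrite <- hp0; clearbody p; destruct p; unfold qadd, qscale, qconj; simpl;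
        f_equal; field).
  apply numrange_triform in hmid; auto; fold a b c in hmid.
  destruct hmid as [x' [y' [z' [hn' hq']]]].
  exact (extremal_real a b c m hm hP hroot x' y' z' hn' hq').
Qed.

(** * The complex numerical range *)

Record cvec := CVec { u1 : R; u2 : R; u3 : R; v1 : R; v2 : R; v3 : R }.

Definition cnorm2 (x : cvec) : R :=
  u1 x * u1 x + u2 x * u2 x + u3 x * u3 x + v1 x * v1 x + v2 x * v2 x + v3 x * v3 x.

(* [cform_re] and [cform_im] are the two parts of [x* A x] for the real matrix [A]
   with entries [a], [b], [c] and the complex vector [x = u + i v]. *)
Definition cform_re (a b c : R) (x : cvec) : R :=
  a * (u1 x * u2 x + v1 x * v2 x) + b * (u1 x * u3 x + v1 x * v3 x)
  + c * (u2 x * u3 x + v2 x * v3 x).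

Definition cform_im (a b c : R) (x : cvec) : R :=
  a * (u1 x * v2 x - v1 x * u2 x) + b * (u1 x * v3 x - v1 x * u3 x)
  + c * (u2 x * v3 x - v2 x * u3 x).

(** Multiplication by the complex scalar [e + i f]. *)
Definition cscale (e f : R) (x : cvec) : cvec :=
  CVec (e * u1 x - f * v1 x) (e * u2 x - f * v2 x) (e * u3 x - f * v3 x)
       (e * v1 x + f * u1 x) (e * v2 x + f * u2 x) (e * v3 x + f * u3 x).

Definition cadd (x y : cvec) : cvec :=
  CVec (u1 x + u1 y) (u2 x + u2 y) (u3 x + u3 y) (v1 x + v1 y) (v2 x + v2 y) (v3 x + v3 y).

Ltac cvec_ring :=
  repeat match goal with x : cvec |- _ => destruct x end;
  cbv [cnorm2 cform_re cform_im cscale cadd u1 u2 u3 v1 v2 v3]; ring.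

Lemma cnorm2_ge0 (x : cvec) : 0 <= cnorm2 x.
Proof. unfold cnorm2; nra. Qed.

Lemma cnorm2_eq0 (x : cvec) : cnorm2 x = 0 -> x = CVec 0 0 0 0 0 0.
Proof.
  intro h; destruct x as [x1 x2 x3 y1 y2 y3]; unfold cnorm2 in h; simpl in h.
  pose proof (Rle_0_sqr x1); pose proof (Rle_0_sqr x2); pose proof (Rle_0_sqr x3);
  pose proof (Rle_0_sqr y1); pose proof (Rle_0_sqr y2); pose proof (Rle_0_sqr y3).
  f_equal; apply Rsqr_0_uniq; unfold Rsqr in *; lra.
Qed.

(* [F] is [x -> x* H x] for a Hermitian [H], expressed through its values only. *)
Definition hermitian (F : cvec -> R) : Prop :=
  (forall e f x, F (cscale e f x) = (e * e + f * f) * F x) /\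
  (forall e f x y, F (cadd (cscale e f x) y)
     = (e * e + f * f) * F x + F y
       + e * (F (cadd x y) - F x - F y) + f * (F (cadd (cscale 0 1 x) y) - F x - F y)).

Lemma cnorm2_hermitian : hermitian cnorm2.
Proof. split; intros; cvec_ring. Qed.

Lemma cform_re_hermitian (a b c : R) : hermitian (cform_re a b c).
Proof. split; intros; cvec_ring. Qed.

Lemma cform_im_hermitian (a b c : R) : hermitian (cform_im a b c).
Proof. split; intros; cvec_ring. Qed.

Lemma hermitian_lin (F G : cvec -> R) (s t : R) :
  hermitian F -> hermitian G ->
  hermitian (fun x => s * F x + t * G x).
Proof.
  intros [hF hF'] [hG hG']; split; intros.
  - rewrite hF, hG; ring.
  - rewrite hF', hG'; ring.
Qed.

Lemma unit_orthogonal (k l : R) : exists e f, e * e + f * f = 1 /\ e * k + f * l = 0.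
Proof.
  destruct (Req_dec (k * k + l * l) 0) as [h | h].
  - exists 1, 0; split; [ring |]; assert (k = 0) by nra; subst; ring.
  - assert (hp : 0 < k * k + l * l) by nra.
    pose proof (sqrt_lt_R0 _ hp) as h0.
    pose proof (sqrt_sqrt (k * k + l * l) (Rlt_le _ _ hp)) as h1.
    set (s := sqrt (k * k + l * l)) in *; clearbody s.
    exists (l / s), (- k / s); split; [| field; lra].
    replace (l / s * (l / s) + - k / s * (- k / s)) with ((k * k + l * l) / (s * s))
      by (field; lra).
    rewrite <- h1; field; lra.
Qed.

(** The leading and constant coefficients [w] and [-w] have opposite signs, so the discriminant
    [m^2 + 4 w^2] is nonnegative. *)
Lemma quadratic_root (w m : R) : 0 < w -> exists t, t * t * w - w + t * m = 0.
Proof.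
  intro hw; assert (hd : 0 <= m * m + 4 * w * w) by nra.
  pose proof (sqrt_sqrt _ hd) as h; set (s := sqrt _) in h; clearbody s.
  exists ((s - m) / (2 * w)).
  replace ((s - m) / (2 * w) * ((s - m) / (2 * w)) * w - w + (s - m) / (2 * w) * m)
    with ((s * s - m * m - 4 * w * w) / (4 * w)) by (field; lra).
  rewrite h; field; lra.
Qed.

(* The heart of the Toeplitz-Hausdorff theorem: some [z = t e x + y] with a phase [e]
   and a real [t] works, where [e] makes the cross term parallel to [(F x, G x)]. *)
Lemma hermitian_common_zero (F G : cvec -> R) (x y : cvec) :
  hermitian F -> hermitian G ->
  F x + F y = 0 -> G x + G y = 0 -> cnorm2 x <> 0 ->
  exists z, cnorm2 z <> 0 /\ F z = 0 /\ G z = 0.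
Proof.
  intros [hF hF'] [hG hG'] hf hg hx.
  destruct (Req_dec (F x * F x + G x * G x) 0) as [h0 | h0].
  { exists x; repeat split; auto; nra. }
  assert (hw : 0 < F x * F x + G x * G x) by nra.
  set (w := F x * F x + G x * G x) in *.
  set (cf1 := F (cadd x y) - F x - F y).
  set (cf2 := F (cadd (cscale 0 1 x) y) - F x - F y).
  set (cg1 := G (cadd x y) - G x - G y).
  set (cg2 := G (cadd (cscale 0 1 x) y) - G x - G y).
  destruct (unit_orthogonal (F x * cg1 - G x * cf1) (F x * cg2 - G x * cf2))
    as [e [f [hef hort]]].
  (* The phase removes the component of [(F z, G z)] orthogonal to [(F x, G x)]; the root [t]
     removes the parallel one. *)
  destruct (quadratic_root w (F x * (e * cf1 + f * cf2) + G x * (e * cg1 + f * cg2)) hw)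
    as [t ht].
  set (z := cadd (cscale (t * e) (t * f) x) y).
  assert (hFz : F z = t * t * F x - F x + t * (e * cf1 + f * cf2)).
  { unfold z; rewrite hF'; fold cf1 cf2.
    replace (t * e * (t * e) + t * f * (t * f)) with (t * t * (e * e + f * f)) by ring.
    rewrite hef; replace (F y) with (- F x) by lra; ring. }
  assert (hGz : G z = t * t * G x - G x + t * (e * cg1 + f * cg2)).
  { unfold z; rewrite hG'; fold cg1 cg2.
    replace (t * e * (t * e) + t * f * (t * f)) with (t * t * (e * e + f * f)) by ring.
    rewrite hef; replace (G y) with (- G x) by lra; ring. }
  assert (hpar : F x * G z - G x * F z = 0).
  { rewrite hFz, hGz.
    transitivity (t * (e * (F x * cg1 - G x * cf1) + f * (F x * cg2 - G x * cf2)));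
      [ring | rewrite hort; ring]. }
  assert (hperp : F x * F z + G x * G z = 0).
  { rewrite hFz, hGz, <- ht; unfold w; ring. }
  assert (hz0 : F z = 0).
  { apply (Rmult_eq_reg_l w); [| lra].
    transitivity (F x * (F x * F z + G x * G z) - G x * (F x * G z - G x * F z));
      [unfold w; ring | rewrite hpar, hperp; ring]. }
  assert (hz1 : G z = 0).
  { apply (Rmult_eq_reg_l w); [| lra].
    transitivity (G x * (F x * F z + G x * G z) + F x * (F x * G z - G x * F z));
      [unfold w; ring | rewrite hpar, hperp; ring]. }
  exists z; repeat split; auto.
  (* If [z = 0], then [y] is [-t] times a phase times [x], so [F y = t^2 F x]. With [F x + F y = 0]
     this gives [F x = 0], and likewise [G x = 0], against [w > 0]. *)
  intro hz.
  assert (hy : y = cscale (- (t * e)) (- (t * f)) x).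
  { apply cnorm2_eq0 in hz; unfold z, cadd, cscale in hz; simpl in hz.
    injection hz; destruct y; unfold cscale; simpl; intros; f_equal; lra. }
  assert (hFy : F y = t * t * F x).
  { rewrite hy, hF; transitivity (t * t * (e * e + f * f) * F x); [ring | rewrite hef; ring]. }
  assert (hGy : G y = t * t * G x).
  { rewrite hy, hG; transitivity (t * t * (e * e + f * f) * G x); [ring | rewrite hef; ring]. }
  assert (hF0 : F x = 0) by nra.
  assert (hG0 : G x = 0) by nra.
  unfold w in hw; rewrite hF0, hG0 in hw; lra.
Qed.

(** The cone over the complex numerical range, with the squared norm as height. Convexity becomes
    closure under sums and nonnegative scaling, with no normalisation of vectors. *)
Definition ccone (a b c n r s : R) : Prop :=
  exists x, cnorm2 x = n /\ cform_re a b c x = r /\ cform_im a b c x = s.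

Lemma ccone_scale (a b c n r s t : R) : 0 <= t ->
  ccone a b c n r s -> ccone a b c (t * n) (t * r) (t * s).
Proof.
  intros ht [x [<- [<- <-]]]; exists (cscale (sqrt t) 0 x).
  rewrite (proj1 cnorm2_hermitian), (proj1 (cform_re_hermitian a b c)),
    (proj1 (cform_im_hermitian a b c)).
  rewrite sqrt_sqrt by auto; repeat split; ring.
Qed.

(** The matrix is real, so conjugating the vector conjugates the value. *)
Lemma ccone_conj (a b c n r s : R) : ccone a b c n r s -> ccone a b c n r (- s).
Proof.
  intros [x [<- [<- <-]]].
  exists (CVec (u1 x) (u2 x) (u3 x) (- v1 x) (- v2 x) (- v3 x)).
  repeat split; cvec_ring.
Qed.

(** Subtracting [T] and [S] times the squared norm from the two forms makes their values at [x] and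
    [y] opposite. A common zero of the shifted forms, rescaled to squared norm [n + n'], is the
    required vector. *)
Lemma ccone_add (a b c n r s n' r' s' : R) :
  ccone a b c n r s -> ccone a b c n' r' s' -> ccone a b c (n + n') (r + r') (s + s').
Proof.
  intros [x [hn [hr hs]]] [y [hn' [hr' hs']]].
  pose proof (cnorm2_ge0 x) as hx; pose proof (cnorm2_ge0 y) as hy.
  destruct (Req_dec (cnorm2 x) 0) as [h0 | h0].
  { apply cnorm2_eq0 in h0; subst x; exists y.
    rewrite <- hn, <- hr, <- hs, <- hn', <- hr', <- hs'.
    repeat split; cvec_ring. }
  set (T := (r + r') / (n + n')); set (S := (s + s') / (n + n')).
  destruct (hermitian_common_zero (fun x => 1 * cform_re a b c x + - T * cnorm2 x)
    (fun x => 1 * cform_im a b c x + - S * cnorm2 x) x y) as [z [hz [h1 h2]]].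
  - apply hermitian_lin; [apply cform_re_hermitian | apply cnorm2_hermitian].
  - apply hermitian_lin; [apply cform_im_hermitian | apply cnorm2_hermitian].
  - rewrite hn, hn', hr, hr'; unfold T; field; lra.
  - rewrite hn, hn', hs, hs'; unfold S; field; lra.
  - auto.
  - pose proof (cnorm2_ge0 z) as hz0.
    replace (n + n') with ((n + n') / cnorm2 z * cnorm2 z) by (field; auto).
    replace (r + r') with ((n + n') / cnorm2 z * cform_re a b c z)
      by (replace (cform_re a b c z) with (T * cnorm2 z) by lra; unfold T; field; lra).
    replace (s + s') with ((n + n') / cnorm2 z * cform_im a b c z)
      by (replace (cform_im a b c z) with (S * cnorm2 z) by lra; unfold S; field; lra).
    apply ccone_scale.
    + apply Rmult_le_pos; [lra | left; apply Rinv_0_lt_compat; lra].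
    + exists z; auto.
Qed.

(** By convexity and the symmetry [s -> -s], the cone contains the whole segment from [-s] to
    [s]. *)
Lemma ccone_shrink (a b c n r s s' : R) :
  ccone a b c n r s -> 0 <= s' <= s -> ccone a b c n r s'.
Proof.
  intros h hs; destruct (Req_dec s 0) as [h0 | h0].
  { replace s' with s by lra; auto. }
  set (t := (1 + s' / s) / 2).
  assert (ht : 0 <= t <= 1).
  { assert (0 <= s' / s) by (apply Rmult_le_pos; [lra | left; apply Rinv_0_lt_compat; lra]).
    assert (s' / s * s = s') by (field; auto).
    unfold t; nra. }
  replace n with (t * n + (1 - t) * n) by ring.
  replace r with (t * r + (1 - t) * r) by ring.
  replace s' with (t * s + (1 - t) * - s) by (unfold t; field; auto).
  apply ccone_add; apply ccone_scale; try lra; auto; apply ccone_conj; auto.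
Qed.

(** * Sufficiency *)

Lemma imnorm_convex (x y : quat) (t : R) : 0 <= t <= 1 ->
  imnorm (qadd (qscale t x) (qscale (1 - t) y)) <= t * imnorm x + (1 - t) * imnorm y.
Proof.
  intro ht.
  pose proof (sqrt_pos (imnorm2 x)) as hx0; pose proof (sqrt_pos (imnorm2 y)) as hy0.
  pose proof (sqrt_sqrt _ (imnorm2_ge0 x)) as hx;
  pose proof (sqrt_sqrt _ (imnorm2_ge0 y)) as hy.
  unfold imnorm; set (sx := sqrt (imnorm2 x)) in *; set (sy := sqrt (imnorm2 y)) in *.
  clearbody sx sy.
  assert (hcs : qi x * qi y + qj x * qj y + qk x * qk y <= sx * sy).
  { destruct (Rle_lt_dec (qi x * qi y + qj x * qj y + qk x * qk y) (sx * sy)) as [h | h]; auto.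
    exfalso; apply (Rlt_irrefl (imnorm2 x * imnorm2 y)).
    assert (h0 : 0 <= sx * sy) by nra.
    pose proof (Rmult_le_0_lt_compat _ _ _ _ h0 h0 h h) as h1.
    replace (sx * sy * (sx * sy)) with (imnorm2 x * imnorm2 y) in h1
      by (rewrite <- hx, <- hy; ring).
    apply Rlt_le_trans with (1 := h1); unfold imnorm2.
    (* Cauchy-Schwarz through Lagrange's identity, whose defect is the sum of these three
       squares. *)
    pose proof (Rle_0_sqr (qi x * qj y - qj x * qi y)).
    pose proof (Rle_0_sqr (qi x * qk y - qk x * qi y)).
    pose proof (Rle_0_sqr (qj x * qk y - qk x * qj y)).
    unfold Rsqr in *; nra. }
  assert (h0 : 0 <= t * sx + (1 - t) * sy) by nra.
  rewrite <- (sqrt_square _ h0); apply sqrt_le_1_alt.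
  replace (imnorm2 (qadd (qscale t x) (qscale (1 - t) y)))
    with (t * t * imnorm2 x + (1 - t) * (1 - t) * imnorm2 y
      + 2 * (t * (1 - t)) * (qi x * qi y + qj x * qj y + qk x * qk y)) by quat_ring.
  rewrite <- hx, <- hy.
  assert (0 <= t * (1 - t)) by nra.
  nra.
Qed.

Lemma polar (q : quat) : exists r u, qnorm2 u = 1 /\ q = qscale r u.
Proof.
  destruct (Req_dec (qnorm2 q) 0) as [h | h].
  - exists 0, qone; split; [quat_ring | apply qnorm2_eq0 in h; subst; quat_ring].
  - pose proof (qnorm2_ge0 q) as h0; assert (hp : 0 < qnorm2 q) by lra.
    pose proof (sqrt_lt_R0 _ hp) as hs0; pose proof (sqrt_sqrt _ h0) as hs.
    set (s := sqrt (qnorm2 q)) in *; clearbody s.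
    exists s, (qscale (/ s) q); split.
    + replace (qnorm2 (qscale (/ s) q)) with (/ s * / s * qnorm2 q) by quat_ring.
      rewrite <- hs; field; lra.
    + destruct q; unfold qscale; simpl; f_equal; field; lra.
Qed.

(** With [D = diag(p, q, r)], the matrix [D* A D] is real with entries [al], [be], [ga]. The phases
    of two entries can always be absorbed; when [a] and [c] are nonzero, reality of [b* a c] settles
    [b]. *)
Lemma diagonal_unitary_real (a b c : quat) : qIsReal (qmul (qmul (qconj b) a) c) ->
  exists p q r al be ga, qnorm2 p = 1 /\ qnorm2 q = 1 /\ qnorm2 r = 1 /\
    a = qscale al (qmul p (qconj q)) /\ b = qscale be (qmul p (qconj r)) /\
    c = qscale ga (qmul q (qconj r)).
Proof.
  intro h.
  destruct (polar a) as [al [p [hp ha]]]; destruct (polar b) as [be [w [hw hb]]];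
  destruct (polar c) as [ga [r [hr hc]]].
  destruct (Req_dec al 0) as [ha0 | ha0]; [| destruct (Req_dec ga 0) as [hc0 | hc0]].
  - exists w, r, qone, 0, be, ga; subst; repeat split; auto; quat_ring.
  - exists qone, (qconj p), (qconj w), al, be, 0; rewrite !qnorm2_conj.
    subst; repeat split; auto; quat_ring.
  (* As [b* a c = al ga g] with [al ga] nonzero, [g] is real, and [b = p r g*] is a real multiple of
     [p r]. *)
  - set (g := qmul (qmul (qconj b) p) r).
    assert (hg : qIsReal g).
    { assert (e : qmul (qmul (qconj b) a) c = qscale (al * ga) g)
        by (rewrite ha, hc; unfold g; quat_ring).
      assert (al * ga <> 0) by (apply Rmult_integral_contrapositive; auto).
      rewrite e in h; destruct h as [k1 [k2 k3]]; simpl in k1, k2, k3.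
      apply Rmult_integral in k1, k2, k3; repeat split; tauto. }
    assert (e : qmul (qmul p r) (qconj g) = qscale (qnorm2 p * qnorm2 r) b)
      by (unfold g; rewrite !qconj_mul; quat_ring).
    destruct g as [g0 g1 g2 g3]; destruct hg as [k1 [k2 k3]]; simpl in k1, k2, k3.
    subst g1 g2 g3.
    exists p, qone, (qconj r), al, g0, ga; rewrite qnorm2_conj; repeat split; auto.
    + quat_ring.
    + rewrite ha; quat_ring.
    + rewrite hp, hr in e; transitivity (qscale (1 * 1) b); [quat_ring |].
      rewrite <- e; quat_ring.
    + rewrite hc; quat_ring.
Qed.

Section RealForm.

Variables (A : mat3) (p q r : quat) (al be ga : R).
Hypotheses (hA : strictly_upper3 A)
  (hp : qnorm2 p = 1) (hq : qnorm2 q = 1) (hr : qnorm2 r = 1)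
  (ha : A 0%nat 1%nat = qscale al (qmul p (qconj q)))
  (hb : A 0%nat 2%nat = qscale be (qmul p (qconj r)))
  (hc : A 1%nat 2%nat = qscale ga (qmul q (qconj r))).

(** The form of [A] at a vector is the real form at its image under [D*], where [D = diag(p, q, r)]
    preserves norms. *)
Lemma numrange_realform (w : quat) :
  numrange A w <-> exists x y z, qnorm2 x + qnorm2 y + qnorm2 z = 1 /\
    triform (Quat al 0 0 0) (Quat be 0 0 0) (Quat ga 0 0 0) x y z = w.
Proof.
  assert (hx : forall u v t x y,
    qmul (qmul (qconj x) (qscale t (qmul u (qconj v)))) y
    = qmul (qmul (qconj (qmul (qconj u) x)) (Quat t 0 0 0)) (qmul (qconj v) y)).
  { intros u v t x y.
    replace (qscale t (qmul u (qconj v))) with (qmul (qmul u (Quat t 0 0 0)) (qconj v))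
      by quat_ring.
    replace u with (qconj (qconj u)) at 1 by quat_ring.
    rewrite !qconj_mul, !qmulA; reflexivity. }
  assert (ht : forall x y z,
    triform (A 0%nat 1%nat) (A 0%nat 2%nat) (A 1%nat 2%nat) x y z
    = triform (Quat al 0 0 0) (Quat be 0 0 0) (Quat ga 0 0 0)
        (qmul (qconj p) x) (qmul (qconj q) y) (qmul (qconj r) z)).
  { intros; rewrite ha, hb, hc; unfold triform; rewrite !hx; reflexivity. }
  rewrite numrange_triform by auto; split; intros [x [y [z [h1 h2]]]].
  - exists (qmul (qconj p) x), (qmul (qconj q) y), (qmul (qconj r) z).
    rewrite !qnorm2_mul, !qnorm2_conj, hp, hq, hr, <- ht; split; auto; lra.
  - exists (qmul p x), (qmul q y), (qmul r z).
    rewrite !qnorm2_mul, hp, hq, hr; split; [lra |].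
    rewrite ht, <- h2; f_equal.
    + transitivity (qscale (qnorm2 p) x); [| rewrite hp]; quat_ring.
    + transitivity (qscale (qnorm2 q) y); [| rewrite hq]; quat_ring.
    + transitivity (qscale (qnorm2 r) z); [| rewrite hr]; quat_ring.
Qed.

(* A quaternionic vector [y + z j] contributes the complex vectors [y] and the
   conjugate of [z] to the component of [x* A x] in the complex plane. *)
Lemma numrange_ccone (w : quat) :
  numrange A w <-> ccone al be ga 1 (qre w) (imnorm w).
Proof.
  rewrite numrange_rotate, numrange_realform by auto; split.
  - intros [x [y [z [h1 h2]]]].
    assert (h3 := f_equal qre h2); assert (h4 := f_equal qi h2).
    cbn [qre] in h3; cbn [qi] in h4.
    rewrite <- h3, <- h4, <- h1.
    set (X := CVec (qre x) (qre y) (qre z) (qi x) (qi y) (qi z)).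
    set (Y := CVec (qj x) (qj y) (qj z) (- qk x) (- qk y) (- qk z)).
    replace (qnorm2 x + qnorm2 y + qnorm2 z) with (cnorm2 X + cnorm2 Y)
      by (unfold X, Y, cnorm2, qnorm2; simpl; ring).
    replace (qre _) with (cform_re al be ga X + cform_re al be ga Y)
      by (unfold X, Y, cform_re, triform, qmul, qadd, qconj; simpl; ring).
    replace (qi _) with (cform_im al be ga X + cform_im al be ga Y)
      by (unfold X, Y, cform_im, triform, qmul, qadd, qconj; simpl; ring).
    (* By Toeplitz-Hausdorff, the two contributions add up to that of a single complex vector. *)
    apply ccone_add; [exists X | exists Y]; auto.
  - intros [x [h1 [h2 h3]]].
    exists (Quat (u1 x) (v1 x) 0 0), (Quat (u2 x) (v2 x) 0 0), (Quat (u3 x) (v3 x) 0 0).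
    split.
    + rewrite <- h1; unfold cnorm2, qnorm2; simpl; ring.
    + rewrite <- h2, <- h3; unfold triform, qmul, qadd, qconj, cform_re, cform_im; simpl.
      f_equal; ring.
Qed.

(** Real parts combine affinely, but the lengths of imaginary parts only satisfy the triangle
    inequality; [ccone_shrink] closes the gap. *)
Lemma convex_numrange_realform : convex (numrange A).
Proof.
  intros x y t hx hy ht; rewrite numrange_ccone in *.
  apply ccone_shrink with (t * imnorm x + (1 - t) * imnorm y).
  - replace 1 with (t * 1 + (1 - t) * 1) at 1 by ring.
    apply ccone_add; apply ccone_scale; auto; lra.
  - split; [apply sqrt_pos | apply imnorm_convex; auto].
Qed.

End RealForm.

Theorem theorem5p3 (A : mat3) (hA : strictly_upper3 A) :
  convex (numrange A) <->
  qIsReal (qmul (qmul (qconj (A 0%nat 2%nat)) (A 0%nat 1%nat)) (A 1%nat 2%nat)).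
Proof.
  split; [apply convex_numrange_real; auto |].
  intro h; destruct (diagonal_unitary_real _ _ _ h)
    as [p [q [r [al [be [ga [hp [hq [hr [ha [hb hc]]]]]]]]]]].
  exact (convex_numrange_realform A p q r al be ga hA hp hq hr ha hb hc).
Qed.
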